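(* Let $A, B\in \mathbb{C}^{m\times n}$ be such that $BA^*=0$ (that is, $A$ is right $*$-orthogonal to $B$). Then $(A+B)^\dagger=A^\dagger + B^\dagger$ if and only if $A^*B(I_n-Q_A)=0$.
   Context: $M^*$ is the conjugate transpose and $M^\dagger$ the Moore-Penrose inverse of $M$; $Q_A=A^\dagger A$ is the orthogonal projector onto the column space of $A^*$. *)

(* Defs.v *)
From mathcomp Require Import all_boot all_order all_algebra.
From mathcomp Require Export complex.
From mathcomp Require Export reals.

Set Implicit Arguments.
Unset Strict Implicit.
Unset Printing Implicit Defensive.

Import Order.TTheory GRing.Theory Num.Theory Num.Def.
Local Open Scope ring_scope.
Local Open Scope sesquilinear_scope.

Section MoorePenrose.

Context {C : numClosedFieldType}.

(* The four Penrose equations. *)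
Definition is_mpinv (m n : nat) (A : 'M[C]_(m, n)) (X : 'M[C]_(n, m)) : bool :=
  [&& A *m X *m A == A,
      X *m A *m X == X,
      (A *m X) ^t* == A *m X
    & (X *m A) ^t* == X *m A].

Lemma trmxC_mul (m n p : nat) (A : 'M[C]_(m, n)) (B : 'M[C]_(n, p)) :
  (A *m B) ^t* = B ^t* *m A ^t*.
Proof. by rewrite trmx_mul map_mxM. Qed.

Lemma mulmx_trmxC_eq0 (m n : nat) (A : 'M[C]_(m, n)) :
  A *m A ^t* = 0 -> A = 0.
Proof.
move=> /matrixP AA0; apply/matrixP => i j; rewrite mxE.
have := AA0 i i; rewrite !mxE => /eqP.
rewrite psumr_eq0 => [/allP/(_ j (mem_index_enum j))|k _].
  by rewrite !mxE mul_conjC_eq0 => /eqP.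
by rewrite !mxE mul_conjC_ge0.
Qed.

Lemma row_free_gram_unit (m n : nat) (A : 'M[C]_(m, n)) :
  row_free A -> A *m A ^t* \in unitmx.
Proof.
move=> Afree; rewrite -row_free_unit; apply: inj_row_free => v.
rewrite mulmxA => vAA0; apply/eqP; rewrite -(mulmx_free_eq0 _ Afree).
by apply/eqP/mulmx_trmxC_eq0; rewrite trmxC_mul mulmxA vAA0 mul0mx.
Qed.

Lemma mpinv_exists (m n : nat) (A : 'M[C]_(m, n)) : exists X, is_mpinv A X.
Proof.
set F := row_base A; set G := col_base A.
have uF : F *m F ^t* \in unitmx.
  by apply/row_free_gram_unit/row_base_free.
have uG : G ^t* *m G \in unitmx.
  rewrite -[X in _ *m X]trmxCK; apply: row_free_gram_unit.
  by rewrite row_free_map /row_free mxrank_tr; exact: col_base_full.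
have GF : A = G *m F by rewrite mulmx_base.
clearbody F G; move: (\rank A) F G uF uG GF => r F G uF uG GF.
have hermV k (M : 'M[C]_k) : M ^t* = M -> (invmx M) ^t* = invmx M.
  by move=> hM; rewrite trmx_inv map_invmx hM.
have hF : (invmx (F *m F ^t*)) ^t* = invmx (F *m F ^t*).
  by apply: hermV; rewrite trmxC_mul trmxCK.
have hG : (invmx (G ^t* *m G)) ^t* = invmx (G ^t* *m G).
  by apply: hermV; rewrite trmxC_mul trmxCK.
pose Y := F ^t* *m invmx (F *m F ^t*).
pose Z := invmx (G ^t* *m G) *m G ^t*.
have FY : F *m Y = 1%:M by rewrite mulmxA mulmxV.
have ZG : Z *m G = 1%:M by rewrite -mulmxA mulVmx.
have AX : A *m (Y *m Z) = G *m Z by rewrite GF -mulmxA (mulmxA F) FY mul1mx.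
have XA : (Y *m Z) *m A = Y *m F by rewrite GF -mulmxA (mulmxA Z) ZG mul1mx.
exists (Y *m Z); rewrite /is_mpinv AX XA; apply/and4P; split; apply/eqP.
- by rewrite GF -mulmxA (mulmxA Z) ZG mul1mx.
- by rewrite -mulmxA (mulmxA F) FY mul1mx.
- by rewrite /Z !trmxC_mul hG trmxCK mulmxA.
- by rewrite /Y !trmxC_mul hF trmxCK mulmxA.
Qed.

Definition mpinv (m n : nat) (A : 'M[C]_(m, n)) : 'M[C]_(n, m) :=
  xchoose (mpinv_exists A).

Lemma mpinvP (m n : nat) (A : 'M[C]_(m, n)) : is_mpinv A (mpinv A).
Proof. exact: xchooseP. Qed.

Lemma mpinv_unique (m n : nat) (A : 'M[C]_(m, n)) (X : 'M[C]_(n, m)) :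
  is_mpinv A X -> X = mpinv A.
Proof.
have /and4P[/eqP] := mpinvP A; move: (mpinv A) => Y.
move=> AYA /eqP YAY /eqP hAY /eqP hYA.
case/and4P=> /eqP AXA /eqP XAX /eqP hAX /eqP hXA.
have AXY : A *m X = A *m Y.
  by rewrite -hAX -{1}AYA -mulmxA trmxC_mul hAX hAY mulmxA AXA.
have XAY : X *m A = Y *m A.
  by rewrite -hXA -{1}AYA -(mulmxA A) mulmxA trmxC_mul hXA hYA -mulmxA
    (mulmxA A) AXA.
by rewrite -XAX -mulmxA AXY mulmxA XAY YAY.
Qed.

(* The orthogonal projector onto the column space of A ^t*. *)
Definition mpQ (m n : nat) (A : 'M[C]_(m, n)) : 'M[C]_n := mpinv A *m A.

End MoorePenrose.

(* Main.v *)
Require Import Defs.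
From mathcomp Require Import all_boot all_order all_algebra.

Import GRing.Theory Num.Theory.
Local Open Scope ring_scope.
Local Open Scope complex_scope.
Local Open Scope sesquilinear_scope.

(** Since [B A^* = 0], also [B A^+ = 0] and [B Q_A = 0], so the right-hand
    condition is just [A^* B = 0]. If it holds, all four cross products
    [A^+ B], [B^+ A], [A B^+], [B A^+] vanish and [A^+ + B^+] satisfies the
    Penrose equations for [A + B]. Conversely, the first Penrose equation for
    [A + B] and [A^+ + B^+] reduces to [A A^+ B + B B^+ A = 0]; multiplying by
    [A^+] on the right kills the first term, so the projectors [B B^+] and
    [A A^+] are orthogonal, whence [A^* B = A^* A A^+ B B^+ B = 0]. *)

Section MoorePenroseSum.

Set Implicit Arguments.
Unset Strict Implicit.

Context {C : numClosedFieldType}.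

Lemma mpinvK (m n : nat) (A : 'M[C]_(m, n)) : A *m mpinv A *m A = A.
Proof. by case/and4P: (mpinvP A) => /eqP. Qed.

Lemma mpinv_mpinvK (m n : nat) (A : 'M[C]_(m, n)) :
  mpinv A *m A *m mpinv A = mpinv A.
Proof. by case/and4P: (mpinvP A) => _ /eqP. Qed.

Lemma trmxC_mulmx_mpinv (m n : nat) (A : 'M[C]_(m, n)) :
  (A *m mpinv A) ^t* = A *m mpinv A.
Proof. by case/and4P: (mpinvP A) => _ _ /eqP. Qed.

Lemma trmxC_mpinv_mulmx (m n : nat) (A : 'M[C]_(m, n)) :
  (mpinv A *m A) ^t* = mpinv A *m A.
Proof. by case/and4P: (mpinvP A) => _ _ _ /eqP. Qed.

Lemma trmxC_eq0 (m n : nat) (A : 'M[C]_(m, n)) : A ^t* = 0 -> A = 0.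
Proof. by move=> A0; rewrite -[A]trmxCK A0 trmx0 map_mx0. Qed.

(** Since [A^+ A] is Hermitian, [A^+ = (A^+ A)^* A^+ = A^* (A^+)^* A^+] starts with the factor
    [A^*]. *)
Lemma mulmx_mpinv_eq0 (m n p : nat) (A : 'M[C]_(m, n)) (B : 'M[C]_(p, n)) :
  B *m A ^t* = 0 -> B *m mpinv A = 0.
Proof.
move=> BA0; rewrite -mpinv_mpinvK -trmxC_mpinv_mulmx trmxC_mul !mulmxA BA0.
by rewrite !mul0mx.
Qed.

(** Since [A A^+] is Hermitian, [A^+ = A^+ (A^+)^* A^*] ends with the factor [A^*]. *)
Lemma mpinv_mulmx_eq0 (m n p : nat) (A : 'M[C]_(m, n)) (B : 'M[C]_(m, p)) :
  A ^t* *m B = 0 -> mpinv A *m B = 0.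
Proof.
move=> AB0; rewrite -mpinv_mpinvK -(mulmxA (mpinv A)) -trmxC_mulmx_mpinv.
by rewrite trmxC_mul -!mulmxA AB0 !mulmx0.
Qed.

Lemma mpinvD_iff (m n : nat) (A B : 'M[C]_(m, n)) : B *m A ^t* = 0 ->
  mpinv (A + B) = mpinv A + mpinv B <-> A ^t* *m B = 0.
Proof.
move=> hBA.
have hAB : A *m B ^t* = 0 by apply: trmxC_eq0; rewrite trmxC_mul trmxCK.
have BA0 := mulmx_mpinv_eq0 hBA.
have AB0 := mulmx_mpinv_eq0 hAB.
have SX : (A + B) *m (mpinv A + mpinv B) = A *m mpinv A + B *m mpinv B.
  by rewrite mulmxDl !mulmxDr BA0 AB0 addr0 add0r.
split=> [sumE | hAB'].
  have := mpinvK (A + B); rewrite sumE SX mulmxDl !mulmxDr !mpinvK.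
  (* Cancel [A] and [B] in [A + A A^+ B + B B^+ A + B = A + B]. *)
  rewrite -addrA => /addrI; rewrite addrA -[RHS]add0r => /addIr.
  move=> /(congr1 (mulmx^~ (mpinv A))); rewrite mul0mx mulmxDl.
  rewrite -!(mulmxA _ B) BA0 mulmx0 add0r -(mulmxA _ A) => QBA.
  (* The adjoint of [QBA], both projectors being Hermitian. *)
  have QAB : A *m mpinv A *m (B *m mpinv B) = 0.
    by apply: trmxC_eq0; rewrite trmxC_mul !trmxC_mulmx_mpinv.
  (* The adjoint of [A A^+ A = A] gives [A^* = A^* A A^+], which brings the two projectors side by
     side. *)
  rewrite -(mpinvK A) trmxC_mul trmxC_mulmx_mpinv -(mpinvK B).
  by rewrite -mulmxA (mulmxA (A *m _)) QAB mul0mx mulmx0.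
have hBA' : B ^t* *m A = 0 by apply: trmxC_eq0; rewrite trmxC_mul trmxCK.
have AB'0 := mpinv_mulmx_eq0 hAB'.
have BA'0 := mpinv_mulmx_eq0 hBA'.
have XS : (mpinv A + mpinv B) *m (A + B) = mpinv A *m A + mpinv B *m B.
  by rewrite mulmxDl !mulmxDr BA'0 AB'0 addr0 add0r.
symmetry; apply: mpinv_unique; rewrite /is_mpinv SX XS.
apply/and4P; split; apply/eqP.
- rewrite mulmxDl !mulmxDr !mpinvK -!mulmxA AB'0 BA'0 !mulmx0.
  by rewrite addr0 add0r.
- rewrite mulmxDl !mulmxDr !mpinv_mpinvK -!mulmxA AB0 BA0 !mulmx0.
  by rewrite addr0 add0r.
- by rewrite linearD map_mxD !trmxC_mulmx_mpinv.
- by rewrite linearD map_mxD !trmxC_mpinv_mulmx.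
Qed.

End MoorePenroseSum.

Theorem theorem2p17 (R : realType) (m n : nat) (A B : 'M[R[i]]_(m, n))
    (hBA : B *m A ^t* = 0) :
  mpinv (A + B) = mpinv A + mpinv B
  <-> A ^t* *m B *m (1%:M - mpQ A) = 0.
Proof.
(* The projector drops out, as [B Q_A = B A^+ A = 0]. *)
rewrite /mpQ mulmxBr mulmx1 -mulmxA (mulmxA B).
rewrite (mulmx_mpinv_eq0 hBA) mul0mx mulmx0 subr0.
exact: mpinvD_iff.
Qed.
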